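(* Let $X$ be a complete $\mathrm{CAT}(0)$ space and let $\Gamma$ be a group of isometries acting on $X$. Let $P\subseteq X$ be a bounded set that is a union of $\Gamma$-orbits, and let $u:P\to\mathbb{R}$ be a bounded non-negative function, not identically $0$, such that $u(p)=u(p')$ whenever $p$ and $p'$ are in the same orbit. Then the barycenter of $P$ relative to $u$ is a common fixed point of $\Gamma$.
   Context: For $P\subseteq X$ bounded and $u:P\to\mathbb{R}$ bounded, non-negative and not identically $0$, the barycenter of $P$ relative to $u$ is the point $q_u\in X$ (which exists and is unique) such that $\sup\{u(p)d(q_u,p)\mid p\in P\}=\inf_{x\in X}\sup\{u(p)d(x,p)\mid p\in P\}$. *)

(* Defs.v *)
From HB Require Import structures.
From mathcomp Require Import all_boot all_order all_algebra.
From mathcomp Require Import all_classical all_reals all_analysis.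

Set Implicit Arguments.
Unset Strict Implicit.
Unset Printing Implicit Defensive.

Import Order.TTheory GRing.Theory Num.Theory.
Import numFieldNormedType.Exports.

Local Open Scope classical_set_scope.
Local Open Scope ring_scope.

(* The norm that the library puts on 'rV[R]_2 is the sup norm, hence the
   explicit Euclidean distance. *)
Definition edist (R : realType) (x y : 'rV[R]_2) : R :=
  Num.sqrt (\sum_(i < 2) (x 0 i - y 0 i) ^+ 2).

Definition esegment (R : realType) (x y : 'rV[R]_2) : set 'rV[R]_2 :=
  [set (1 - t) *: x + t *: y | t in `[0, 1]].

Section Metric.
Context {R : realType} (X : metricType R).

(* Same axiom as in completeType, without a distinguished point in X. *)
Definition complete_space : Prop :=
  forall F : set_system X, ProperFilter F -> cauchy F -> exists l : X, F --> l.

Definition bounded_subset (P : set X) : Prop :=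
  exists M : R, forall x y, P x -> P y -> mdist x y <= M.

Definition geodesic_path (c : R -> X) (x y : X) : Prop :=
  [/\ c 0 = x, c (mdist x y) = y &
      {in `[0, mdist x y] &, forall s t, mdist (c s) (c t) = `|s - t|}].

Definition geodesic_segment (x y : X) (S : set X) : Prop :=
  exists2 c : R -> X, geodesic_path c x y & S = c @` `[0, mdist x y].

Definition geodesic_space : Prop :=
  forall x y : X, exists c : R -> X, geodesic_path c x y.

(* The vertices of a triangle are indexed cyclically by 'I_3: side i joins
   vertex i to vertex ordS i. *)
Definition geodesic_triangle (v : 'I_3 -> X) (S : 'I_3 -> set X) : Prop :=
  forall i, geodesic_segment (v i) (v (ordS i)) (S i).

Definition comparison_triangle (v : 'I_3 -> X) (w : 'I_3 -> 'rV[R]_2) : Prop :=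
  forall i j, edist (w i) (w j) = mdist (v i) (v j).

Definition comparison_point (v : 'I_3 -> X) (w : 'I_3 -> 'rV[R]_2) (i : 'I_3)
    (x : X) (x' : 'rV[R]_2) : Prop :=
  esegment (w i) (w (ordS i)) x' /\ edist (w i) x' = mdist (v i) x.

(* Quantifying over all comparison triangles is harmless: one always exists
   and is unique up to an isometry of the plane. *)
Definition CAT0 : Prop :=
  geodesic_space /\
  forall v S w, geodesic_triangle v S -> comparison_triangle v w ->
  forall i j x y x' y', S i x -> S j y ->
    comparison_point v w i x x' -> comparison_point v w j y y' ->
    mdist x y <= edist x' y'.

(* Together with closure under inverses, preservation of the distance makes
   every element a bijective isometry. *)
Definition isometry_group (G : set (X -> X)) : Prop :=
  [/\ forall g, G g -> forall x y, mdist (g x) (g y) = mdist x y,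
      G id,
      forall g h, G g -> G h -> G (g \o h) &
      forall g, G g -> exists h, [/\ G h, cancel g h & cancel h g]].

Definition orbit_of (G : set (X -> X)) (x : X) : set X := [set g x | g in G].

Definition union_of_orbits (G : set (X -> X)) (P : set X) : Prop :=
  exists A : set X, P = \bigcup_(x in A) orbit_of G x.

(* For u bounded and non-negative and P bounded and nonempty, the sets below
   are nonempty and bounded, so that the real-valued sup and inf are genuine. *)
Definition weighted_radius (P : set X) (u : P -> R) (x : X) : R :=
  sup (range (fun p : P => u p * mdist x (val p))).

Definition is_barycenter (P : set X) (u : P -> R) (q : X) : Prop :=
  weighted_radius u q = inf (range (weighted_radius u)).

End Metric.

(* Main.v *)
Require Import Defs.
From HB Require Import structures.
From mathcomp Require Import all_boot all_order all_algebra.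
From mathcomp Require Import all_classical all_reals all_analysis.
From mathcomp Require Import lra ring.
Import Order.TTheory GRing.Theory Num.Theory.
Import numFieldNormedType.Exports.
Local Open Scope classical_set_scope.
Local Open Scope ring_scope.

(** Write f(x) = sup_p u(p) d(x,p) and r = inf f. The barycenters are the
    minimizers of f. Since u is constant on orbits and P is a union of orbits,
    an isometry g of the group permutes the terms of the supremum up to moving
    x, so f(g x) <= f(x) ([orbit_weight_invariant]); hence g maps a minimizer
    to a minimizer, and fixes it as soon as the minimizer is unique.

    Existence and uniqueness both come from well-posedness: points at which f
    is close to r are close to one another ([weighted_radius_well_posed]). In
    a complete space the sublevel sets {f < r + d} then generate a Cauchy
    filter, whose limit is a minimizer because f is Lipschitz
    ([well_posed_minimum]).

    Well-posedness is where the curvature condition enters. Comparing a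
    triangle x, y, p with the Euclidean plane gives the Bruhat-Tits inequality
    d(m,p)^2 <= (d(x,p)^2 + d(y,p)^2)/2 - d(x,y)^2/4 for a midpoint m of x and
    y ([CAT0_midpoint]). If f(x), f(y) <= r + d, then
    (u(p) d(m,p))^2 + (u(p) d(x,y))^2/4 <= (r+d)^2 for all p. As f(m) >= r,
    some p has u(p) d(m,p) > r - d, which bounds u(p) d(x,y) by a quantity
    vanishing with d. This is of no use if u(p) is small; but d(m,p) stays
    bounded, so when r > 0 the choice of p also bounds u(p) away from 0.
    When r = 0, a single point p with u(p) > 0 forces x and y to be near p. *)

Local Notation edist := Defs.edist.

(** * Comparison triangles in the plane *)

Lemma edist_sqr {R : realType} (x y : 'rV[R]_2) :
  edist x y ^+ 2 = (x 0 0 - y 0 0) ^+ 2 + (x 0 1 - y 0 1) ^+ 2.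
Proof.
rewrite /edist sqr_sqrtr; last by apply: sumr_ge0 => i _; exact: sqr_ge0.
by rewrite !big_ord_recl big_ord0 addr0; congr (_ + (x 0 _ - y 0 _) ^+ 2);
  apply: val_inj.
Qed.

Lemma edist_ge0 {R : realType} (x y : 'rV[R]_2) : 0 <= edist x y.
Proof. exact: sqrtr_ge0. Qed.

Lemma edist_eq {R : realType} (x y : 'rV[R]_2) (d : R) : 0 <= d ->
  (x 0 0 - y 0 0) ^+ 2 + (x 0 1 - y 0 1) ^+ 2 = d ^+ 2 -> edist x y = d.
Proof.
move=> d0 h; apply/eqP; rewrite -(@eqrXn2 _ 2) ?edist_ge0 //.
by rewrite edist_sqr h.
Qed.

(** Place the side of length a on the first axis with one end at the origin;
    (s, t) is then the third vertex. *)
Lemma comparison_triangle_coordinates {R : realType} (a b c : R) :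
  0 <= a -> 0 <= b -> 0 <= c -> a <= b + c -> b <= a + c -> c <= a + b ->
  exists s t : R, s ^+ 2 + t ^+ 2 = b ^+ 2 /\ (s - a) ^+ 2 + t ^+ 2 = c ^+ 2.
Proof.
move=> a0 b0 c0 abc bac cab; have [a_gt0|] := ltP 0 a; last first.
  by move=> ale0; exists 0, b; split; nra.
(* The law of cosines determines s; the triangle inequalities give |s| <= b. *)
pose s := (a ^+ 2 + b ^+ 2 - c ^+ 2) / (2 * a).
have sa : s * a *+ 2 = a ^+ 2 + b ^+ 2 - c ^+ 2.
  by rewrite /s; field; rewrite gt_eqF.
have sb : s ^+ 2 <= b ^+ 2.
  have h1 : s <= b by nra.
  have h2 : - b <= s by nra.
  by nra.
exists s, (Num.sqrt (b ^+ 2 - s ^+ 2)).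
rewrite sqr_sqrtr ?subr_ge0 //; split; nra.
Qed.

Lemma comparison_triangle_exists {R : realType} {X : metricType R}
  (v : 'I_3 -> X) : exists w, comparison_triangle v w.
Proof.
have [|||||| s [t [hb hc]]] := @comparison_triangle_coordinates R
  (mdist (v 0) (v 1)) (mdist (v 0) (v 2)) (mdist (v 1) (v 2));
  rewrite ?mdist_ge0 //.
- by rewrite (metric_sym (v 1)); exact: metric_triangle.
- exact: metric_triangle.
- by rewrite (metric_sym (v 0) (v 1)); exact: metric_triangle.
pose pt (a b : R) : 'rV[R]_2 := \row_j nth 0 [:: a; b] j.
exists (fun i => nth 0 [:: 0; pt (mdist (v 0) (v 1)) 0; pt s t] i).
have ord3 (i : 'I_3) : [\/ i = 0, i = 1 | i = 2].
  by case: i => [[|[|[|//]]] ?]; [apply: Or31|apply: Or32|apply: Or33];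
    apply: val_inj.
by move=> i j; apply: edist_eq; rewrite ?mdist_ge0 //;
  case: (ord3 i) => ->; case: (ord3 j) => -> /=; rewrite !mxE /=;
  rewrite ?mdistxx ?(metric_sym (v 1) (v 0)) ?(metric_sym (v 2) (v 0))
    ?(metric_sym (v 2) (v 1)) -?hb -?hc; ring.
Qed.

(** * The Bruhat-Tits inequality *)

Lemma euclidean_median {R : realType} (x y z : 'rV[R]_2) :
  edist ((1 - 2^-1) *: x + 2^-1 *: y) z ^+ 2 =
  (edist x z ^+ 2 + edist y z ^+ 2) / 2 - edist x y ^+ 2 / 4.
Proof. by rewrite !edist_sqr !mxE; field. Qed.

(** The comparison inequality applied to the midpoint of one side and the
    opposite vertex, combined with the median formula in the plane. The
    midpoint is chosen before p and serves all p, since the radius at m is a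
    supremum over p. *)
Lemma CAT0_midpoint {R : realType} {X : metricType R} : CAT0 X ->
  forall x y : X, exists m, forall p,
    mdist m p ^+ 2 <=
    (mdist x p ^+ 2 + mdist y p ^+ 2) / 2 - mdist x y ^+ 2 / 4.
Proof.
move=> [geo cmp] x y; have [c cP] := geo x y.
exists (c (mdist x y / 2)) => p.
have [c1 c1P] := geo y p; have [c2 c2P] := geo p x.
pose v (i : 'I_3) : X := nth x [:: x; y; p] i.
pose S (i : 'I_3) : set X := nth set0 [:: c @` `[0, mdist x y];
  c1 @` `[0, mdist y p]; c2 @` `[0, mdist p x]] i.
have vS : geodesic_triangle v S.
  by case=> [[|[|[|//]]] ?]; [exists c|exists c1|exists c2].
have [w vw] := comparison_triangle_exists v.
have d0 : 0 <= mdist x y := mdist_ge0 x y.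
have half : mdist x y / 2 \in `[0, mdist x y] by rewrite in_itv /=; lra.
have S0 : S 0 (c (mdist x y / 2)) by exists (mdist x y / 2).
(* The vertex p is viewed as the initial point of the side from p to x. *)
have S2 : S 2 p.
  by exists 0; [rewrite /= in_itv /= lexx mdist_ge0|case: c2P].
have e01 : edist (w 0) (w 1) = mdist x y by rewrite vw.
have ordS0 : ordS (0 : 'I_3) = 1 by apply: val_inj.
pose w' := (1 - 2^-1) *: w 0 + 2^-1 *: w 1.
have P0 : comparison_point v w 0 (c (mdist x y / 2)) w'.
  split; first by exists 2^-1; rewrite ?ordS0 //= in_itv /=; lra.
  have [c0 _ ciso] := cP.
  have -> : mdist (v 0) (c (mdist x y / 2)) = mdist x y / 2.
    rewrite -[v 0]/x -{1}c0 ciso // ?in_itv /= ?lexx ?mdist_ge0 //.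
    by rewrite sub0r normrN ger0_norm //; lra.
  apply: edist_eq; first lra.
  by rewrite expr_div_n -e01 edist_sqr !mxE; field.
have P2 : comparison_point v w 2 p (w 2).
  split; last by rewrite vw.
  exists 0; first by rewrite /= in_itv /= lexx ler01.
  by rewrite subr0 scale1r scale0r addr0.
have := cmp _ _ _ vS vw _ _ _ _ _ _ S0 S2 P0 P2.
rewrite -(@ler_pXn2r _ 2) ?nnegrE ?mdist_ge0 ?edist_ge0 //.
by rewrite euclidean_median !vw.
Qed.

(** * Well-posed minimization *)

(** Points with nearly minimal value cluster, so that the sublevel sets form a
    Cauchy filter basis; the Lipschitz bound makes the limit of this filter a
    minimizer. *)
Lemma well_posed_minimum {R : realType} {X : metricType R} (f : X -> R)
    (K : R) : complete_space X -> [set: X] !=set0 -> has_lbound (range f) ->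
  (forall x y, f y <= f x + K * mdist x y) ->
  (forall e, 0 < e -> exists2 d, 0 < d &
     forall x y, f x <= inf (range f) + d -> f y <= inf (range f) + d ->
     mdist x y <= e) ->
  exists q, unique (fun x => f x = inf (range f)) q.
Proof.
set r := inf _ => cX [x0 _] fb flip wp.
have r_le x : r <= f x by apply: ge_inf => //; exists x.
have near_min d : 0 < d -> exists x, f x < r + d.
  move=> d0; have [||_ [x _ <-] hx] := @inf_adherent _ (range f) d => //.
    by split=> //; exists (f x0), x0.
  by exists x.
pose F : set_system X :=
  [set A | exists2 d, 0 < d & forall x, f x < r + d -> A x].
have FF : ProperFilter F.
  split.
    by move=> [d d0 h]; have [x /h] := near_min d d0.
  split.
  - by exists 1.
  - move=> A B [d d0 hA] [e e0 hB]; exists (Num.min d e) => [|x hx].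
      by rewrite lt_min d0.
    split; [apply: hA|apply: hB]; apply: (lt_le_trans hx);
      by rewrite lerD2l ge_min lexx ?orbT.
  - by move=> A B AB [d d0 hA]; exists d => // x /hA /AB.
have Fcauchy : cauchy F.
  apply: cauchy_exP => e e0.
  have [|d d0 hd] := wp (e / 2); first by rewrite divr_gt0.
  have [x hx] := near_min d d0.
  exists x, d => // y hy; rewrite ballEmdist /=.
  by have := hd x y (ltW hx) (ltW hy); lra.
have [q Fq] := cX F FF Fcauchy.
have fq : f q = r.
  apply/eqP; rewrite eq_le r_le andbT; apply/ler_addgt0Pl => e e0.
  have K1 : 0 < `|K| + 1 by have := normr_ge0 K; lra.
  have e2 : 0 < e / 2 / (`|K| + 1) by rewrite !divr_gt0.
  have [d d0 hd] := Fq _ (nbhsx_ballx q _ e2).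
  have [|x hx] := near_min (Num.min d (e / 2)).
    by rewrite lt_min d0 divr_gt0.
  have : ball q (e / 2 / (`|K| + 1)) x.
    by apply: hd; apply: (lt_le_trans hx); rewrite lerD2l ge_min lexx.
  rewrite ballEmdist /= metric_sym ltr_pdivlMr // => qx.
  have hx2 : f x < r + e / 2.
    by apply: (lt_le_trans hx); rewrite lerD2l ge_min lexx orbT.
  have := flip x q; have := mdist_ge0 x q; have := ler_norm K; nra.
exists q; split=> // y fy; apply: mdist_positivity.
apply/eqP; rewrite eq_le mdist_ge0 andbT; apply/ler_addgt0Pl => e e0.
have [d d0 hd] := wp e e0; rewrite addr0; apply: hd; rewrite ?fq ?fy; lra.
Qed.

(** * The weighted radius *)

Section WeightedRadius.
Context {R : realType} {X : metricType R} {P : set X} {u : P -> R}.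
Hypotheses (Pbounded : bounded_subset P) (u_bounded : bounded_fun u).
Hypotheses (u_ge0 : forall p, 0 <= u p).

Lemma weight_bound : exists2 K, 0 <= K & forall p, u p <= K.
Proof.
have [M [_ MP]] := u_bounded.
exists (`|M| + 1); first by have := normr_ge0 M; lra.
move=> p; apply: (le_trans (ler_norm _)); apply: (MP (`|M| + 1)) => //.
by have := ler_norm M; lra.
Qed.

Lemma weighted_radius_ge x (p : P) :
  u p * mdist x (val p) <= weighted_radius u x.
Proof.
apply: ub_le_sup; last by exists p.
have [K K0 uK] := weight_bound; have [M PM] := Pbounded.
exists (K * (mdist x (val p) + M)) => _ [p' _ <-].
have := PM _ _ (set_valP p) (set_valP p').
have := metric_triangle x (val p) (val p').
have := mdist_ge0 x (val p'); have := u_ge0 p'; have := uK p'; nra.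
Qed.

Lemma weighted_radius_le (p0 : P) x s :
  (forall p : P, u p * mdist x (val p) <= s) -> weighted_radius u x <= s.
Proof.
move=> xs; apply: ge_sup; first by exists (u p0 * mdist x (val p0)), p0.
by move=> _ [p _ <-].
Qed.

Lemma weighted_radius_lipschitz (p0 : P) : exists K, forall x y,
  weighted_radius u y <= weighted_radius u x + K * mdist x y.
Proof.
have [K K0 uK] := weight_bound; exists K => x y.
apply: (weighted_radius_le p0) => p.
have := weighted_radius_ge x p; have := metric_triangle y x (val p).
rewrite (metric_sym y x).
have := mdist_ge0 x y; have := u_ge0 p; have := uK p; nra.
Qed.

Lemma weighted_radius_has_lbound (p0 : P) :
  has_lbound (range (weighted_radius u)).
Proof.
exists 0 => _ [x _ <-]; apply: le_trans (weighted_radius_ge x p0).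
by rewrite mulr_ge0 // mdist_ge0.
Qed.

(** Uniform convexity in quantitative form: at the midpoint m of two almost
    minimal points, the Bruhat-Tits inequality would push the radius below its
    infimum unless these points are close. *)
Lemma weighted_radius_well_posed : CAT0 X -> (exists p, u p != 0) ->
  forall e, 0 < e -> exists2 d, 0 < d & forall x y,
    weighted_radius u x <= inf (range (weighted_radius u)) + d ->
    weighted_radius u y <= inf (range (weighted_radius u)) + d ->
    mdist x y <= e.
Proof.
set r := inf _ => cat0 [p0 up0] e e0.
have u0 : 0 < u p0 by rewrite lt0r up0 u_ge0.
have r_le x : r <= weighted_radius u x.
  by apply: ge_inf; [exact: weighted_radius_has_lbound p0|exists x].
have r_ge0 : 0 <= r.
  apply: lb_le_inf => [|_ [x _ <-]].
    by exists (weighted_radius u (val p0)), (val p0).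
  by apply: le_trans (weighted_radius_ge x p0); rewrite mulr_ge0 ?mdist_ge0.
have [r0|r_gt0] := leP r 0.
  (* Here r = 0, and both points lie within e / 2 of p0. *)
  exists (u p0 * e / 2); first by rewrite divr_gt0 // mulr_gt0.
  move=> x y hx hy; rewrite -(ler_pM2l u0).
  have := weighted_radius_ge x p0; have := weighted_radius_ge y p0.
  have := metric_triangle x (val p0) y; rewrite (metric_sym (val p0) y).
  nra.
have [M PM] := Pbounded.
have M0 : 0 <= M.
  by have := PM _ _ (set_valP p0) (set_valP p0); rewrite mdistxx.
(* For the midpoint m considered below, D bounds the distance from m to any
   point of P, since u p0 * mdist m p0 <= r + d <= 2 r; L is the resulting lower bound for the weight of
   a point almost realizing the radius at m. *)
pose D := 2 * r / u p0 + M.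
have D0 : 0 < D by rewrite ltr_wpDr // divr_gt0 // mulr_gt0.
have [L L0 LD] : exists2 L, 0 < L & L * D = r / 2.
  by exists (r / 2 / D); [rewrite !divr_gt0|rewrite divfK // gt_eqF].
(* Chosen so that (r + d)^2 - (r - d)^2 = 4 r d is at most (L e)^2 / 4. *)
pose d := Num.min (r / 2) (L ^+ 2 * e ^+ 2 / (16 * r)).
have d0 : 0 < d.
  have LE : 0 < L ^+ 2 * e ^+ 2 by rewrite mulr_gt0 // exprn_gt0.
  by rewrite lt_min !divr_gt0 // mulr_gt0.
have d_r : d <= r / 2 by rewrite ge_min lexx.
have d_e : d * (16 * r) <= L ^+ 2 * e ^+ 2.
  by rewrite -ler_pdivlMr ?mulr_gt0 // ge_min lexx orbT.
exists d => // x y hx hy.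
have [m mP] := CAT0_midpoint cat0 x y.
have rd0 : 0 <= r + d by rewrite addr_ge0 // ltW.
have convex p : (u p * mdist m (val p)) ^+ 2 + (u p * mdist x y) ^+ 2 / 4
    <= (r + d) ^+ 2.
  have := mP (val p).
  have up := u_ge0 p.
  have hxp := le_trans (weighted_radius_ge x p) hx.
  have hyp := le_trans (weighted_radius_ge y p) hy.
  have hx2 : (u p * mdist x (val p)) ^+ 2 <= (r + d) ^+ 2.
    by rewrite ler_sqr ?nnegrE ?mulr_ge0 ?mdist_ge0 //.
  have hy2 : (u p * mdist y (val p)) ^+ 2 <= (r + d) ^+ 2.
    by rewrite ler_sqr ?nnegrE ?mulr_ge0 ?mdist_ge0 //.
  rewrite !exprMn in hx2 hy2 *.
  by have := sqr_ge0 (u p); nra.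
have convex_le p : u p * mdist m (val p) <= r + d.
  rewrite -ler_sqr ?nnegrE ?mulr_ge0 ?mdist_ge0 //.
  by have := convex p; have := sqr_ge0 (u p * mdist x y); lra.
have [p mp] : exists p, r - d < u p * mdist m (val p).
  apply: contrapT => /forallNP far.
  have : weighted_radius u m <= r - d.
    by apply: (weighted_radius_le p0) => p; rewrite leNgt; apply/negP/far.
  by have := r_le m; lra.
have mD : mdist m (val p) <= D.
  have mp0 : mdist m (val p0) <= 2 * r / u p0.
    by rewrite ler_pdivlMr // mulrC; apply: le_trans (convex_le p0) _; lra.
  apply: le_trans (metric_triangle _ (val p0) _) _.
  by apply: lerD => //; apply: PM; exact: set_valP.
have uL : L <= u p.
  rewrite -(ler_pM2r D0) LD.
  have := ler_wpM2l (u_ge0 p) mD; lra.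
have : (u p * mdist x y) ^+ 2 <= 16 * r * d.
  have : (r - d) ^+ 2 <= (u p * mdist m (val p)) ^+ 2.
    by rewrite ler_sqr ?nnegrE ?mulr_ge0 ?mdist_ge0 //; lra.
  by have := convex p; nra.
move=> uxy; rewrite -(ler_pM2l L0).
have [L_ge0 e_ge0] := (ltW L0, ltW e0).
rewrite -ler_sqr ?nnegrE ?mulr_ge0 ?mdist_ge0 //.
apply: (@le_trans _ _ ((u p * mdist x y) ^+ 2)).
  by apply: lerXn2r; rewrite ?nnegrE ?mulr_ge0 ?mdist_ge0 // ler_wpM2r ?mdist_ge0.
by rewrite (le_trans uxy) // [leRHS]exprMn; lra.
Qed.

End WeightedRadius.

(** * Invariance under the group *)

(** The group permutes P and preserves weights; it is this form of the
    hypotheses that lets a group element be moved across the supremum. *)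
Lemma orbit_weight_invariant {R : realType} {X : metricType R}
    (G : set (X -> X)) (P : set X) (u : P -> R) :
  isometry_group G -> union_of_orbits G P ->
  (forall (x : X) (p p' : P),
     orbit_of G x (val p) -> orbit_of G x (val p') -> u p = u p') ->
  forall g (p : P), G g -> exists2 p' : P, val p' = g (val p) & u p' = u p.
Proof.
move=> [_ _ Gcomp _] [A PA] hGu g p Gg.
have PE y : P y -> (\bigcup_(x in A) orbit_of G x) y by rewrite -PA.
have EP y : (\bigcup_(x in A) orbit_of G x) y -> P y by rewrite -PA.
have [x Ax [h Gh hx]] := PE _ (set_valP p).
have Pgp : g (val p) \in P.
  by apply: mem_set; apply: EP; exists x => //; exists (g \o h);
    [exact: Gcomp|rewrite /= hx].
exists (SigSub Pgp) => //; apply: (hGu x); last by exists h.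
by exists (g \o h); [exact: Gcomp|rewrite /= hx].
Qed.

Theorem proposition6 (R : realType) (X : metricType R)
    (hcomplete : complete_space X) (hcat0 : CAT0 X)
    (G : set (X -> X)) (hG : isometry_group G)
    (P : set X) (hPbounded : bounded_subset P) (hPorbits : union_of_orbits G P)
    (u : P -> R) (hubounded : bounded_fun u) (hu0 : forall p : P, 0 <= u p)
    (hunz : exists p : P, u p != 0)
    (hGu : forall (x : X) (p p' : P),
       orbit_of G x (val p) -> orbit_of G x (val p') -> u p = u p') :
  exists2 q : X, unique (is_barycenter u) q & forall g, G g -> g q = q.
Proof.
have [p0 _] := hunz.
have [K lipK] := weighted_radius_lipschitz hPbounded hubounded hu0 p0.
have lb := weighted_radius_has_lbound hPbounded hubounded hu0 p0.
have [|q [qbar quniq]] := well_posed_minimum _ _ hcomplete _ lb lipK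
  (weighted_radius_well_posed hPbounded hubounded hu0 hcat0 hunz).
  by exists (val p0).
exists q => // g Gg; apply/esym/quniq/eqP; rewrite eq_le.
apply/andP; split; last by apply: ge_inf => //; exists (g q).
rewrite -qbar; apply: (weighted_radius_le p0) => p.
have [Giso _ _ Ginv] := hG; have [h [Gh _ hK]] := Ginv g Gg.
(* mdist (g q) p = mdist q (h p) for h inverse to g, and h p has the weight
   of p. *)
have [p' p'E <-] := orbit_weight_invariant _ _ _ hG hPorbits hGu h p Gh.
rewrite -(hK (val p)) Giso // -p'E.
exact: weighted_radius_ge.
Qed.
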